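(* Let $G$ be a connected edge-weighted undirected graph, let $\mathrm{MST}(G)$ be a minimum spanning tree of $G$, and let $E^+$ be a set of new weighted edges on the vertices of $G$. Let $C$ be the compressed path tree of $\mathrm{MST}(G)$ with respect to the set of endpoints of edges in $E^+$, and let $M$ be a minimum spanning tree of the graph $C\cup E^+$. Identifying each edge of $C$ with a heaviest edge of $\mathrm{MST}(G)$ on the path it represents (the one whose weight it carries), the edge set $$M' = \mathrm{MST}(G) \cup (E(M)\cap E^+) \setminus (E(C)\setminus E(M))$$ is a minimum spanning tree of $G\cup E^+$.
   Context: Compressed path tree: given an edge-weighted tree and a set $S$ of marked vertices, take the subgraph formed by the union of the tree paths between all pairs of marked vertices, and then repeatedly splice out every unmarked vertex of degree two (replacing its two incident edges by a single edge). Each edge of the result is labeled with the weight of the heaviest edge of the original tree on the path it represents, and is identified with that heaviest edge. *)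

(* Defs.v *)
From HB Require Import structures.
From mathcomp Require Import all_boot all_order all_algebra.
From Stdlib Require Import Relations.Relation_Operators.

Set Implicit Arguments.
Unset Strict Implicit.
Unset Printing Implicit Defensive.

Import Order.TTheory GRing.Theory Num.Theory.

(* Finite undirected multigraphs.  [E] is a type of edge names: parallel edges *)
(* are distinct names with the same ends.  The pair [ends e] is read as an     *)
(* unordered pair, and is irrelevant when [e \notin eset].                     *)
Record mgraph (V E : finType) := MGraph {
  vset : {set V};
  eset : {set E};
  ends : E -> V * V
}.

Section Multigraph.
Variables (V E : finType).
Implicit Types (G : mgraph V E) (F : {set E}).

Definition wf_mgraph G : Prop :=
  forall e, e \in eset G -> (ends G e).1 \in vset G /\ (ends G e).2 \in vset G.

Definition joins G (e : E) (x y : V) : bool :=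
  (ends G e == (x, y)) || (ends G e == (y, x)).

Definition adj G F : rel V := fun x y => [exists e in F, joins G e x y].

(* The empty graph counts as connected, so that its spanning tree exists; this *)
(* is needed when no edge is added and the compressed path tree is empty.      *)
Definition connected G F : Prop := {in vset G &, forall x y, connect (adj G F) x y}.

(* A walk starting at [x] is the list of its successive (edge, next vertex).   *)
Fixpoint walk G F (x : V) (p : seq (E * V)) : bool :=
  if p is (e, y) :: p' then [&& e \in F, joins G e x y & walk G F y p'] else true.

Definition simple_path G F (x y : V) (p : seq (E * V)) : bool :=
  [&& walk G F x p, last x (unzip2 p) == y & uniq (x :: unzip2 p)].

(* Loops (length 1) and pairs of parallel edges (length 2) are cycles; the     *)
(* distinctness of edges excludes traversing one edge back and forth.          *)
Definition is_cycle G F (x : V) (p : seq (E * V)) : bool :=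
  [&& p != [::], walk G F x p, last x (unzip2 p) == x,
      uniq (unzip2 p) & uniq (unzip1 p)].

Definition acyclic G F : Prop := forall x p, ~~ is_cycle G F x p.

Definition spanning_tree G F : Prop :=
  [/\ F \subset eset G, connected G F & acyclic G F].

Definition is_mst (R : realDomainType) (w : E -> R) G F : Prop :=
  spanning_tree G F /\
  forall F', spanning_tree G F' ->
    (\sum_(e in F) w e <= \sum_(e in F') w e)%R.

(* Loops count twice. *)
Definition degree G (v : V) : nat :=
  \sum_(e in eset G) (((ends G e).1 == v) + ((ends G e).2 == v)).

Definition endpoints F (f : E -> V * V) : {set V} :=
  [set v | [exists e in F, (v == (f e).1) || (v == (f e).2)]].

Definition add_edges G F (f : E -> V * V) : mgraph V E :=
  MGraph (vset G) (eset G :|: F) (fun e => if e \in F then f e else ends G e).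

End Multigraph.

(* An edge of a compressed graph: its two ends, together with the set of edges *)
(* of the path of the original tree that it represents.                        *)
Definition cedge (V E : finType) : finType := (V * V * {set E})%type.

Section CompressedPathTree.
Variables (V E : finType).
Implicit Types (G : mgraph V E) (C : mgraph V (cedge V E)).

(* [U] and [F] are the vertices and edges of the union of the paths of the     *)
(* tree [T] between pairs of vertices of [S].                                  *)
Definition path_union G (T : {set E}) (S : {set V}) (U : {set V}) (F : {set E}) : Prop :=
  (forall v, v \in U <->
     exists x y p, [/\ x \in S, y \in S, simple_path G T x y p & v \in x :: unzip2 p]) /\
  (forall e, e \in F <->
     exists x y p, [/\ x \in S, y \in S, simple_path G T x y p & e \in unzip1 p]).

Definition uncompressed G (U : {set V}) (F : {set E}) : mgraph V (cedge V E) :=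
  MGraph U [set ((ends G e, [set e]) : cedge V E) | e in F]
    (fun c : cedge V E => c.1).

Inductive splice (S : {set V}) C : mgraph V (cedge V E) -> Prop :=
| Splice (v a b : V) (c1 c2 : cedge V E) :
    v \in vset C -> v \notin S -> degree C v = 2 ->
    c1 \in eset C -> c2 \in eset C -> c1 != c2 ->
    joins C c1 a v -> joins C c2 v b ->
    splice S C
      (MGraph (vset C :\ v)
        (((a, b, c1.2 :|: c2.2) : cedge V E) |: (eset C :\ c1 :\ c2))
        (ends C)).

(* A relation and not a function: the orientation of the ends of a new edge    *)
(* depends on how the splices are performed.                                   *)
Definition compressed_path_tree G (T : {set E}) (S : {set V}) C : Prop :=
  exists U F, [/\ path_union G T S U F,
    clos_refl_trans_1n _ (splice S) (uncompressed G U F) C &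
    forall v, v \in vset C -> v \notin S -> degree C v != 2].

Definition heaviest_rep (R : realDomainType) (w : E -> R) C (rep : cedge V E -> E) : Prop :=
  forall c, c \in eset C ->
    rep c \in c.2 /\ forall e, e \in c.2 -> (w e <= w (rep c))%R.

(* [C] with each edge [c] renamed to [rep c].  In a compressed path tree the   *)
(* represented paths are edge-disjoint, so [rep] is injective on [eset C] when *)
(* [rep c] is on the path represented by [c].  The ends [f] are a dummy value  *)
(* for names that are not edges of the result.                                 *)
Definition identify C (rep : cedge V E -> E) (f : E -> V * V) : mgraph V E :=
  MGraph (vset C) (rep @: eset C)
    (fun e => if [pick c in eset C | rep c == e] is Some c then ends C c else f e).

End CompressedPathTree.

(* Main.v *)
(* A spanning tree F is minimum iff the ends of every edge e of the graph are
   joined by edges of F of weight at most w e.  This threshold criterion passes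
   from T and M to M': an edge of T missing in M' is the heaviest edge of a path
   represented by an edge of C, whose ends are joined in M by edges that are not
   heavier, and each edge of M is either new or represents a path kept in M'.
   Hence M' connects, and M' has at most as many edges as T because the forest M
   has at most as many edges as the connected graph C; so M' is a tree. *)
Require Import Defs.
From HB Require Import structures.
From mathcomp Require Import all_boot all_order all_algebra.

Set Implicit Arguments.
Unset Strict Implicit.
Unset Printing Implicit Defensive.

Import Order.TTheory GRing.Theory Num.Theory.

(** * Connectivity by edge sets, forests, and exchange of edges *)

Definition equiv (V : Type) (r : rel V) : Prop :=
  [/\ reflexive r, symmetric r & transitive r].

Section Connectivity.
Variables (V E : finType).
Implicit Types (G : mgraph V E) (A B F : {set E}) (r : rel V).

Definition edge_rel G r : pred E := fun e => r (ends G e).1 (ends G e).2.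

Definition conn G F : rel V := connect (adj G F).

(** Acyclicity without walks: every edge of [F] is a bridge. [acyclic_forest] proves the two notions
    equivalent. *)
Definition forest G F : Prop := {in F, forall e, ~~ edge_rel G (conn G (F :\ e)) e}.

Lemma joins_equiv G r e x y : equiv r -> joins G e x y -> edge_rel G r e = r x y.
Proof.
by case=> _ rS _; rewrite /joins /edge_rel => /orP[]/eqP-> //=.
Qed.

Lemma conn_equiv G F : equiv (conn G F).
Proof.
split; [exact: connect0 | | exact: connect_trans].
apply: sym_connect_sym => x y; rewrite /adj.
by apply: eq_existsb => e; rewrite /joins orbC.
Qed.

(** Universal property of connectivity, used below in place of induction on paths. Since [r] is
    arbitrary, it also applies to connectivity in another graph or pulled back along a map of
    vertices. *)
Lemma conn_least G F r x y :
  equiv r -> {in F, forall e, edge_rel G r e} -> conn G F x y -> r x y.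
Proof.
move=> rE rF /connectP[p + ->] {y}; have [r0 _ rT] := rE.
elim: p x => [|y p IHp] x //= /andP[/exists_inP[e eF exy]] /IHp.
by apply: rT; rewrite -(joins_equiv rE exy) rF.
Qed.

Lemma conn_edge G F e : e \in F -> edge_rel G (conn G F) e.
Proof.
move=> eF; apply: connect1; apply/exists_inP; exists e => //.
by rewrite /joins -surjective_pairing eqxx.
Qed.

Lemma conn_sub G A B x y : A \subset B -> conn G A x y -> conn G B x y.
Proof.
by move=> /subsetP AB; apply: conn_least (conn_equiv _ _) _ => e /AB; apply: conn_edge.
Qed.

(* Gluing the class of one end of [f] to the class of the other end describes
   the connectivity of [f |: A]. *)
Lemma conn_exchange G A f u v r :
    conn G (f |: A) u v -> ~~ conn G A u v ->
    equiv r -> {in A, forall e, edge_rel G r e} -> r u v -> edge_rel G r f.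
Proof.
move=> uv nuv rE rA ruv; have [r0 rS rT] := rE.
have [k0 kS kT] := conn_equiv G A.
have kr x y : conn G A x y -> r x y by apply: conn_least.
set s := (ends G f).1; set t := (ends G f).2.
pose phi x := if conn G A x t then s else x.
have : conn G A (phi u) (phi v).
  apply: (@conn_least G (f |: A) (fun x y => conn G A (phi x) (phi y))) uv.
    by split=> [x|x y|y x z]; [apply: k0 | apply: kS | apply: kT].
  move=> e /setU1P[->|eA]; rewrite /edge_rel /phi -/s -/t.
    by rewrite k0; case: ifP; rewrite k0.
  have ke := conn_edge G eA; have ket := same_connect kS ke t.
  rewrite -!/(conn _ _ _ _) in ket; rewrite ket.
  by case: ifP => // _; apply: k0.
(* Gluing identifies [u] and [v], which [A] separates, so one of them lies in the class of [t] and
   the other in the class of [s]. As [r] contains [conn G A], relating [u] to [v] relates [s] to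
   [t]. *)
rewrite /edge_rel -/s -/t /phi; case: ifP => ut; case: ifP => vt sv.
- by rewrite (kT _ _ _ ut) // kS in nuv.
- by apply: (rT v); [apply: kr | apply: (rT u); [rewrite rS | apply: kr]].
- by apply: (rT u); [rewrite rS; apply: kr | apply: (rT v); last apply: kr].
- by rewrite sv in nuv.
Qed.

(** If adding [f] made an old edge [e] redundant, the exchange property, applied to the ends of [e],
    would show that [A] already joins the ends of [f]. *)
Lemma forest_add G A f :
  forest G A -> ~~ edge_rel G (conn G A) f -> forest G (f |: A).
Proof.
move=> Afor nf; have fA : f \notin A by apply: contra nf; apply: conn_edge.
move=> e /setU1P[->|eA]; first by rewrite setU1K.
have nef : e != f by apply: contraNneq fA => <-.
apply: contra nf => ce.
have eqA : (f |: A) :\ e = f |: (A :\ e).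
  by apply/setP=> x; rewrite !inE; case: eqP => // ->; rewrite (negPf nef).
rewrite eqA in ce; apply: (conn_exchange ce (Afor e eA) (conn_equiv G A)).
  by move=> g /setD1P[_]; apply: conn_edge.
exact: conn_edge.
Qed.

Lemma not_edge_rel_exists G F r x y :
  equiv r -> conn G F x y -> ~~ r x y -> exists2 f, f \in F & ~~ edge_rel G r f.
Proof.
move=> rE xy; case: (boolP [exists f in F, ~~ edge_rel G r f]).
  by case/exists_inP=> f; exists f.
rewrite negb_exists_in => /forall_inP rF /negP[]; apply: conn_least xy => // f fF.
by rewrite -[edge_rel _ _ _]negbK rF.
Qed.

(** Steinitz exchange. For [a] in [A] but not in [B], the set [B] joins the ends of [a] while
    [A :\ a] does not, so some [b] in [B] has ends separated by [A :\ a]. Replacing [a] by [b] keeps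
    a forest of the same size that is closer to [B]. *)
Lemma forest_card_le G A B :
  forest G A -> {in A, forall a, edge_rel G (conn G B) a} -> #|A| <= #|B|.
Proof.
have [n] := ubnP #|A :\: B|; elim: n A => // n IHn A ltn Afor AB.
have [/subset_leq_card //|] := boolP (A \subset B).
case/subsetPn=> a aA aB.
have [b bB nb] := not_edge_rel_exists (conn_equiv _ _) (AB a aA) (Afor a aA).
have nba : b != a by apply: contraNneq aB => <-.
have bA : b \notin A by apply: contra nb => bA; apply: conn_edge; rewrite !inE nba.
have -> : #|A| = #|b |: (A :\ a)|.
  by rewrite cardsU1 !inE (negPf bA) andbF (cardsD1 a A) aA.
apply: IHn.
- apply: leq_trans (_ : #|A :\: B| <= n); last by [].
  apply: proper_card; apply/properP; split; last first.
    by exists a; rewrite !inE ?aA ?aB // eqxx eq_sym (negPf nba).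
  apply/subsetP=> x; rewrite !inE => /andP[xB].
  by case/orP=> [/eqP xb|/andP[_ ->]]; [rewrite xb bB in xB | rewrite xB].
- apply: forest_add nb => e /setD1P[_ eA]; apply: contra (Afor e eA).
  by apply: conn_sub; apply/setSD/subD1set.
- by move=> e /setU1P[->|/setD1P[_ /AB]//]; apply: conn_edge.
Qed.

End Connectivity.

(** * Walks, simple paths, and the two notions of acyclicity *)

Section Walks.
Variables (V E : finType).
Implicit Types (G : mgraph V E) (A F : {set E}) (x y : V) (p : seq (E * V)).

Lemma walk_sub G F x p : walk G F x p -> {subset unzip1 p <= F}.
Proof.
elim: p x => [|[e y] p IHp] x //= /and3P[eF _ /IHp pF] f.
by rewrite inE => /orP[/eqP->|/pF].
Qed.

Lemma walk_conn G F A x p v :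
  walk G F x p -> {subset unzip1 p <= A} -> v \in x :: unzip2 p -> conn G A x v.
Proof.
have [k0 _ kT] := conn_equiv G A.
elim: p x => [|[e y] p IHp] x /=; first by rewrite inE => _ _ /eqP->.
case/and3P=> _ exy yp pA; rewrite inE => /predU1P[->//|vp].
apply: (kT y); first rewrite -(joins_equiv (conn_equiv G A) exy).
  by apply: conn_edge; rewrite pA ?mem_head.
by apply: IHp => // f fp; apply: pA; rewrite inE fp orbT.
Qed.

Lemma walk_ends G F x p e :
  walk G F x p -> e \in unzip1 p ->
  (ends G e).1 \in x :: unzip2 p /\ (ends G e).2 \in x :: unzip2 p.
Proof.
elim: p x => [|[f y] p IHp] x //= /and3P[_ fxy yp].
rewrite inE => /predU1P[->|/(IHp _ yp)[e1 e2]].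
  by case/orP: fxy => /eqP->; rewrite !inE !eqxx !orbT.
by split; rewrite inE ?e1 ?e2 orbT.
Qed.

(** If the first edge were used again, both of its ends, and so the starting vertex, would be
    visited later. *)
Lemma uniq_walk_edges G F x p :
  walk G F x p -> uniq (x :: unzip2 p) -> uniq (unzip1 p).
Proof.
elim: p x => [|[e y] p IHp] x //= /and3P[_ exy yp] /andP[xp up].
rewrite (IHp y) // andbT; apply: contra xp => /(walk_ends yp)[].
by case/orP: exy => /eqP->.
Qed.

Lemma conn_simple_path G F x y : conn G F x y -> exists p, simple_path G F x y p.
Proof.
case/connectP=> q; case/shortenP=> {}q qp qu _ ->.
suff [p wp pq] : exists2 p, walk G F x p & unzip2 p = q.
  by exists p; rewrite /simple_path wp pq eqxx qu.
elim: q x qp {qu} => [|z q IHq] x /=; first by exists [::].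
case/andP=> /exists_inP[e eF exz] /IHq[p wp <-].
by exists ((e, z) :: p) => //=; rewrite eF exz wp.
Qed.

(** A simple path in [F :\ e] between the ends of [e] closes up with [e] to a cycle; conversely, a
    cycle without its first edge still joins the ends of that edge. *)
Lemma acyclic_forest G F : acyclic G F <-> forest G F.
Proof.
split=> [acF e eF | Ffor x [|[e y] p]]; last 2 first.
- by rewrite /is_cycle eqxx.
- apply/negP=> /and5P[_ /= /and3P[eF exy wp] /eqP lp _ /andP[ep _]].
  move/negP: (Ffor e eF); apply; have kE := conn_equiv G (F :\ e).
  rewrite (joins_equiv kE exy); have [_ -> _] := kE.
  rewrite -lp; apply: (walk_conn wp) (mem_last _ _) => f fp.
  by rewrite !inE (walk_sub wp fp) andbT; apply: contraNneq ep => <-.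
apply/negP=> ke; have [_ kS _] := conn_equiv G (F :\ e).
rewrite /edge_rel kS in ke; have [p /and3P[wp lp up]] := conn_simple_path ke.
move/negP: (acF (ends G e).1 ((e, (ends G e).2) :: p)); apply.
have wF q z : walk G (F :\ e) z q -> walk G F z q.
  elim: q z => [|[g t] q IHq] z //= /and3P[/setD1P[_ ->] -> /IHq->] //.
rewrite /is_cycle /= eF wF //= lp (uniq_walk_edges wp up) andbT.
rewrite {1}/joins -surjective_pairing eqxx /=; apply/andP; split=> //.
by rewrite andbT; apply/negP=> ep; have := walk_sub wp ep; rewrite !inE eqxx.
Qed.

End Walks.

(** * Spanning trees and the threshold criterion for minimality *)

Section MinimumSpanningTrees.
Variables (V E : finType) (G : mgraph V E).
Hypothesis wfG : wf_mgraph G.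
Implicit Types (A B F : {set E}).

Lemma connected_edge_rel F e : connected G F -> e \in eset G -> edge_rel G (conn G F) e.
Proof. by move=> cF /wfG[]; apply: cF. Qed.

Lemma connected_absorb A B :
  connected G A -> {in A, forall a, edge_rel G (conn G B) a} -> connected G B.
Proof.
by move=> cA AB x y xG yG; apply: (conn_least (conn_equiv _ _) AB); apply: cA.
Qed.

(** If an edge [b] of [B] were redundant, [B :\ b] would still connect the graph, so the forest [A]
    would have fewer edges than [B]. *)
Lemma spanning_tree_card A B :
  spanning_tree G A -> B \subset eset G -> connected G B -> #|B| <= #|A| ->
  spanning_tree G B.
Proof.
move=> [AG cA /acyclic_forest Afor] BG cB leBA; split=> //.
apply/acyclic_forest => b bB; apply: contraL leBA => kb.
rewrite -ltnNge (cardsD1 b B) bB add1n ltnS.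
apply: forest_card_le Afor _ => a /(subsetP AG); apply: connected_edge_rel.
apply: connected_absorb cB _ => c cB; have [->//|ncb] := eqVneq c b.
by apply: conn_edge; rewrite !inE ncb.
Qed.

(** Only connectivity has to be checked, since the swap does not increase the number of edges;
    acyclicity then follows by counting. *)
Lemma spanning_tree_swap F e f :
  spanning_tree G F -> e \in eset G -> f \in F ->
  edge_rel G (conn G (e |: (F :\ f))) f -> spanning_tree G (e |: (F :\ f)).
Proof.
move=> stF eG fF kf; have [FG cF _] := stF.
apply: (spanning_tree_card stF).
- by rewrite subUset sub1set eG (subset_trans (subD1set _ _) FG).
- apply: connected_absorb cF _ => g gF; have [->//|ngf] := eqVneq g f.
  by apply: conn_edge; rewrite !inE ngf gF orbT.
- by rewrite cardsU1 (cardsD1 f F) fF leq_add2r leq_b1.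
Qed.

Variables (R : realDomainType) (w : E -> R).
Local Open Scope ring_scope.

Definition light F (t : R) : {set E} := [set f in F | w f <= t].

Lemma sum_swap F e f : e \notin F -> f \in F ->
  \sum_(g in e |: (F :\ f)) w g = \sum_(g in F) w g + (w e - w f).
Proof.
move=> eF fF; rewrite (big_setD1 f fF) /= big_setU1 ?inE ?(negPf eF) ?andbF //=.
by rewrite [RHS]addrC addrA subrK.
Qed.

(** Otherwise the ends of [e] are joined in [F] only with the help of an edge heavier than [e], and
    exchanging that edge for [e] gives a lighter spanning tree. *)
Lemma mst_light F e :
  is_mst w G F -> e \in eset G -> edge_rel G (conn G (light F (w e))) e.
Proof.
move=> [stF minF] eG; have [FG cF _] := stF.
apply/negPn/negP => nke; set L := light _ _ in nke.
have LF : L \subset F by apply/subsetP=> f; rewrite inE => /andP[].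
(* A minimal [A] between [L] and [F] that joins the ends of [e] stands in for the tree path: an edge
   of [A] outside [L] is heavier than [e], and removing it separates these ends. *)
pose P A := (L \subset A) && edge_rel G (conn G A) e.
have PF : P F by rewrite /P LF connected_edge_rel.
have [A /minsetP[/andP[LA kA] minA] AF] := minset_exists PF.
have /subsetPn[f fA fL] : ~~ (A \subset L).
  by apply: contra nke => /conn_sub; apply.
have fF := subsetP AF f fA.
have lt_ef : w e < w f by move: fL; rewrite inE fF /= -ltNge.
have nkf : ~~ edge_rel G (conn G (A :\ f)) e.
  apply/negP=> kf; suff : f \in A :\ f by rewrite !inE eqxx.
  rewrite (minA (A :\ f)) ?subD1set //= /P kf andbT.
  by apply/subsetP=> g gL; rewrite !inE (subsetP LA) // andbT; apply: contraNneq fL => <-.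
have eF : e \notin F.
  by apply: contra nke => eF; apply: conn_edge; rewrite inE eF lexx.
have kf : edge_rel G (conn G (e |: (F :\ f))) f.
  rewrite /edge_rel -(setD1K fA) in kA.
  apply: (conn_exchange kA nkf (conn_equiv _ _)).
    move=> g /setD1P[ngf gA]; apply: conn_edge.
    by rewrite !inE ngf (subsetP AF) ?orbT.
  by apply: conn_edge; rewrite setU11.
have := minF _ (spanning_tree_swap stF eG fF kf).
by rewrite sum_swap // lerDl subr_ge0 leNgt lt_ef.
Qed.

(** Induction on the number of edges of [F'] outside [F]: such an edge [e] is replaced by some [f]
    of [F] that is not heavier, which brings [F'] closer to [F] without raising its weight. When
    [F'] is contained in [F], counting edges makes them equal. *)
Lemma light_mst F :
  spanning_tree G F ->
  {in eset G, forall e, edge_rel G (conn G (light F (w e))) e} -> is_mst w G F.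
Proof.
move=> stF lightF; split=> // F'; have [FG cF /acyclic_forest Ffor] := stF.
have [n] := ubnP #|F' :\: F|; elim: n F' => // n IHn F' ltn stF'.
have [F'G cF' /acyclic_forest F'for] := stF'.
have [F'F|/subsetPn[e eF' eF]] := boolP (F' \subset F).
  suff /eqP-> : F' == F by [].
  rewrite eqEcard F'F; apply: forest_card_le Ffor _ => a /(subsetP FG).
  exact: connected_edge_rel.
have eG := subsetP F'G e eF'.
have [f] := not_edge_rel_exists (conn_equiv _ _) (lightF e eG) (F'for e eF').
rewrite inE => /andP[fF le_fe] nkf; have fG := subsetP FG f fF.
have nfe : f != e by apply: contraNneq eF => <-.
have fF' : f \notin F'.
  by apply: contra nkf => fF'; apply: conn_edge; rewrite !inE nfe.
have ke : edge_rel G (conn G (f |: (F' :\ e))) e.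
  have kf := connected_edge_rel cF' fG; rewrite /edge_rel -(setD1K eF') in kf.
  apply: (conn_exchange kf nkf (conn_equiv _ _)).
    by move=> g gF'; apply: conn_edge; rewrite inE gF' orbT.
  by apply: conn_edge; rewrite setU11.
apply: le_trans (IHn _ _ (spanning_tree_swap stF' fG eF' ke)) _; last first.
  by rewrite sum_swap // gerDl subr_le0.
apply: leq_trans (_ : (#|F' :\: F| <= n)%N); last by [].
apply: proper_card; apply/properP; split; last first.
  by exists e; rewrite !inE ?eF' ?eF // eqxx eq_sym (negPf nfe).
apply/subsetP=> x; rewrite !inE => /andP[xF].
by case/orP=> [/eqP xf|/andP[_ ->]]; [rewrite xf fF in xF | rewrite xF].
Qed.

End MinimumSpanningTrees.

(** * An invariant of splicing, inherited by the compressed path tree *)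

Section CompressedPathTrees.
Variables (V E : finType) (G : mgraph V E) (T : {set E}) (S : {set V}).
Implicit Types (C : mgraph V (cedge V E)) (c : cedge V E).

(* What is needed of the fact that [c.2] is the edge set of a path between the
   ends of [c]: the ends of [c] are connected by [c.2], and each edge [f] of the
   path lies on the cycle that the path forms with [c]. *)
Definition path_like c : Prop :=
  (forall r, equiv r -> {in c.2, forall e, edge_rel G r e} -> r c.1.1 c.1.2) /\
  (forall f r, equiv r -> f \in c.2 -> {in c.2 :\ f, forall e, edge_rel G r e} ->
     r c.1.1 c.1.2 -> edge_rel G r f).

Record cpt_inv C : Prop := CptInv {
  inv_ends : forall c, ends C c = c.1;
  inv_wf : wf_mgraph C;
  inv_marked : S \subset vset C;
  inv_connected : connected C (eset C);
  inv_disjoint : {in eset C &, forall c c', c != c' -> [disjoint c.2 & c'.2]};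
  inv_sub : {in eset C, forall c, c.2 \subset T};
  inv_path : {in eset C, forall c, path_like c} }.

(** The edges [c1] and [c2] contribute at least one each to the degree of [v], and a loop
    contributes two. Degree two therefore rules out loops among them and any third edge at [v]. *)
Lemma degree2_incident C v c1 c2 a b :
    degree C v = 2 -> c1 \in eset C -> c2 \in eset C -> c1 != c2 ->
    joins C c1 a v -> joins C c2 v b ->
  [/\ a != v, b != v &
      {in eset C, forall c, c != c1 -> c != c2 ->
         (ends C c).1 != v /\ (ends C c).2 != v}].
Proof.
move=> deg c1C c2C n12 j1 j2.
pose inc c := ((ends C c).1 == v) + ((ends C c).2 == v).
have i1 : inc c1 = (a == v).+1.
  by rewrite /inc; case/orP: j1 => /eqP->; rewrite /= eqxx ?addn1 ?add1n.
have i2 : inc c2 = (b == v).+1.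
  by rewrite /inc; case/orP: j2 => /eqP->; rewrite /= eqxx ?addn1 ?add1n.
have c2C' : c2 \in eset C :\ c1 by rewrite !inE eq_sym n12.
move: deg; rewrite /degree (big_setD1 c1) //= (big_setD1 c2) //= -!/(inc _) i1 i2.
case: (a == v); case: (b == v); rewrite ?addSn ?addnS ?add0n //.
case=> /eqP; rewrite sum_nat_eq0 => /forall_inP inc0; split=> // c cC nc1 nc2.
have := inc0 c; rewrite !inE nc1 nc2 cC => /(_ isT).
by rewrite addn_eq0 !eqb0 => /andP.
Qed.

(** Frees [path_like] from the stored orientation of [c], which a symmetric [r] cannot see. *)
Lemma joins_path_like C c a b :
  (forall c, ends C c = c.1) -> joins C c a b -> path_like c ->
  (forall r, equiv r -> {in c.2, forall e, edge_rel G r e} -> r a b) /\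
  (forall f r, equiv r -> f \in c.2 -> {in c.2 :\ f, forall e, edge_rel G r e} ->
     r a b -> edge_rel G r f).
Proof.
move=> eC jc [ends_c cycle_c].
have rab r : equiv r -> r c.1.1 c.1.2 = r a b.
  by move=> rE; rewrite -(joins_equiv rE jc) /edge_rel eC.
split=> [r rE rc | f r rE fc rc]; first by rewrite -rab //; apply: ends_c.
by rewrite -rab //; apply: cycle_c.
Qed.

(** By disjointness, deleting [f] from one of the two paths leaves the other intact. Going along the
    intact path turns the relation between [a] and [b] into one between the ends of the damaged
    path, whose own cycle property then applies. *)
Lemma path_like_cat C c1 c2 a b v :
  (forall c, ends C c = c.1) -> joins C c1 a v -> joins C c2 v b ->
  path_like c1 -> path_like c2 -> [disjoint c1.2 & c2.2] ->
  path_like (a, b, c1.2 :|: c2.2).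
Proof.
move=> eC j1 j2 /(joins_path_like eC j1)[e1 y1] /(joins_path_like eC j2)[e2 y2] dis.
have sub1 f : f \in c2.2 -> {subset c1.2 <= (c1.2 :|: c2.2) :\ f}.
  move=> f2 g g1; rewrite !inE g1 andbT.
  by apply: contraTneq f2 => <-; rewrite (disjointFr dis).
have sub2 f : f \in c1.2 -> {subset c2.2 <= (c1.2 :|: c2.2) :\ f}.
  move=> f1 g g2; rewrite !inE g2 orbT andbT.
  by apply: contraTneq f1 => <-; rewrite (disjointFl dis).
split=> [r rE rc | f r rE fc rc rab] /=.
  have [_ _ rT] := rE; apply: (rT v); [apply: e1 | apply: e2] => // e ec.
    by apply: rc; rewrite inE ec.
  by apply: rc; rewrite inE ec orbT.
have [_ rS rT] := rE; case/setUP: fc => fc.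
- apply: y1 => // [g /setD1P[ngf g1]|]; first by apply: rc; rewrite !inE ngf g1.
  apply: (rT b) => //; rewrite rS; apply: e2 => // g g2.
  by apply: rc; apply: sub2.
- apply: y2 => // [g /setD1P[ngf g2]|]; first by apply: rc; rewrite !inE ngf g2 orbT.
  apply: (rT a); last exact: rab.
  by rewrite rS; apply: e1 => // g g1; apply: rc; apply: sub1.
Qed.

Lemma splice_inv C C1 : splice S C C1 -> cpt_inv C -> cpt_inv C1.
Proof.
case=> v a b c1 c2 vC vS deg c1C c2C n12 j1 j2 [eC wfC SC cC disC subC pathC].
have [nav nbv ninc] := degree2_incident deg c1C c2C n12 j1 j2.
set c0 : cedge V E := (a, b, c1.2 :|: c2.2).
have oldP c : c \in eset C :\ c1 :\ c2 -> [/\ c \in eset C, c != c1 & c != c2].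
  by rewrite !inE => /and3P[].
have aC : a \in vset C.
  by have [] := wfC _ c1C; case/orP: j1 => /eqP->.
have bC : b \in vset C.
  by have [] := wfC _ c2C; case/orP: j2 => /eqP->.
have dis0 c : c \in eset C :\ c1 :\ c2 -> [disjoint c0.2 & c.2].
  case/oldP=> cC' nc1 nc2; rewrite disjoints_subset subUset -!disjoints_subset.
  by rewrite !disC // eq_sym.
split=> //=.
- move=> c /setU1P[->|/oldP[cC' nc1 nc2]] /=.
    by rewrite eC !inE aC bC nav nbv.
  have [n1 n2] := ninc c cC' nc1 nc2; have [m1 m2] := wfC c cC'.
  by rewrite !inE n1 n2 m1 m2.
- apply/subsetP=> x xS; rewrite !inE (subsetP SC) // andbT.
  by apply: contraNneq vS => <-.
- set D := MGraph _ _ _; move=> x y /setD1P[nxv xC] /setD1P[nyv yC].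
  have kE := conn_equiv D (eset D); have [k0 kS kT] := kE.
  (* Contracting [v] onto [a] makes [c1] trivial, sends [c2] to the new edge [c0] and fixes all
     other edges, so connectivity of [C] passes to the spliced graph. *)
  pose phi z := if z == v then a else z.
  have phiE z : z != v -> phi z = z by rewrite /phi => /negPf->.
  have phiv : phi v = a by rewrite /phi eqxx.
  pose r z t := conn D (eset D) (phi z) (phi t).
  have rE : equiv r.
    by split=> [z|z t|t z u]; [apply: k0 | apply: kS | apply: kT].
  suff : r x y by rewrite /r !phiE.
  apply: (conn_least rE _ (cC x y xC yC)) => c cC'.
  have [->|nc1] := eqVneq c c1.
    by rewrite (joins_equiv rE j1) /r phiv phiE.
  have [->|nc2] := eqVneq c c2.
    rewrite (joins_equiv rE j2) /r phiv phiE //.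
    have := @conn_edge _ _ D (eset D) c0 (setU11 _ _).
    by rewrite /edge_rel /= eC.
  have [m1 m2] := ninc c cC' nc1 nc2; rewrite /edge_rel /r !phiE //.
  by apply: (@conn_edge _ _ D); rewrite !inE nc1 nc2 cC' orbT.
- move=> c c' /setU1P[->|cO] /setU1P[->|cO'] ncc.
  + by rewrite eqxx in ncc.
  + exact: dis0.
  + by rewrite disjoint_sym dis0.
  + by have [? _ _] := oldP _ cO; have [? _ _] := oldP _ cO'; apply: disC.
- move=> c /setU1P[->|/oldP[cC' _ _]]; last exact: subC.
  by rewrite subUset !subC.
- move=> c /setU1P[->|/oldP[cC' _ _]]; last exact: pathC.
  by apply: (path_like_cat eC j1 j2); [apply: pathC | apply: pathC | apply: disC].
Qed.

Lemma uncompressed_inv U F :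
  S \subset vset G -> connected G T -> path_union G T S U F ->
  cpt_inv (uncompressed G U F).
Proof.
move=> SG cT [UP FP]; set C := uncompressed G U F.
have eF e : e \in F -> ((ends G e, [set e]) : cedge V E) \in eset C.
  by move=> eF; apply/imsetP; exists e.
split=> //=.
- move=> c /imsetP[e /FP[x [y [p [xS yS sp ep]]]] ->] /=.
  have [wp _ _] := and3P sp; have [e1 e2] := walk_ends wp ep.
  by split; apply/UP; exists x, y, p.
- apply/subsetP=> x xS; apply/UP; exists x, x, [::].
  by rewrite /simple_path /= eqxx mem_head.
- have kE := conn_equiv C (eset C); have [k0 kS kT] := kE.
  have GC x y : conn G F x y -> conn C (eset C) x y.
    apply: conn_least => // e /eF eC.
    exact: (@conn_edge _ _ C (eset C) _ eC).
  have pathF x y p v : x \in S -> y \in S -> simple_path G T x y p ->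
      v \in x :: unzip2 p -> conn C (eset C) x v.
    move=> xS yS sp vp; apply: GC; have [wp _ _] := and3P sp.
    by apply: walk_conn wp _ vp => e ep; apply/FP; exists x, y, p.
  (* Each of [u] and [v] is joined to the marked start of its path, and the tree path between these
     two starts belongs to the union as well. *)
  move=> u v /UP[x [y [p [xS yS sp up]]]] /UP[z [t [q [zS tS sq vq]]]].
  have [s ss] := conn_simple_path (cT x z (subsetP SG x xS) (subsetP SG z zS)).
  have xz : conn C (eset C) x z.
    apply: (pathF _ _ _ _ _ _ ss) => //; have /and3P[_ /eqP<- _] := ss; exact: mem_last.
  apply: (kT x); first by rewrite kS; apply: pathF sp up.
  by apply: (kT z) => //; apply: pathF sq vq.
- move=> _ _ /imsetP[e _ ->] /imsetP[f _ ->] nef /=.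
  rewrite disjoints1 inE; apply: contraNneq nef => -> //.
- move=> _ /imsetP[e /FP[x [y [p [_ _ /and3P[wp _ _] ep]]]] ->] /=.
  by rewrite sub1set (walk_sub wp).
- move=> _ /imsetP[e _ ->]; split=> [r rE|f r rE] /=; first by apply; rewrite inE.
  by rewrite inE => /eqP->.
Qed.

Lemma compressed_path_tree_inv C :
  S \subset vset G -> connected G T -> compressed_path_tree G T S C -> cpt_inv C.
Proof.
move=> SG cT [U [F [/(uncompressed_inv SG cT) inv CC _]]].
elim: CC inv => // C1 C2 C3 C12 _ IH inv1; apply: IH.
exact: splice_inv C12 inv1.
Qed.

End CompressedPathTrees.

Theorem theorem9 (R : realDomainType) (V E : finType) (w : E -> R)
    (G : mgraph V E) (T : {set E})
    (EP : {set E}) (endsP : E -> V * V)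
    (C : mgraph V (cedge V E)) (rep : cedge V E -> E) (M : {set E}) :
  wf_mgraph G ->
  connected G (eset G) ->
  is_mst w G T ->
  [disjoint EP & eset G] ->
  endpoints EP endsP \subset vset G ->
  compressed_path_tree G T (endpoints EP endsP) C ->
  heaviest_rep w C rep ->
  let C' := identify C rep (ends G) in
  is_mst w (add_edges C' EP endsP) M ->
  is_mst w (add_edges G EP endsP)
    ((T :|: (M :&: EP)) :\: (eset C' :\: M)).
Proof.
move=> wfG _ mstT disEP SG cptC hrep C' mstM.
have [[TG cT _] _] := mstT.
have [eC wfC SC cC disC subC pathC] := compressed_path_tree_inv SG cT cptC.
set M' := _ :\: _; set G1 := add_edges G EP endsP; set C1 := add_edges C' EP endsP.
have endsS e : e \in EP ->
    (endsP e).1 \in endpoints EP endsP /\ (endsP e).2 \in endpoints EP endsP.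
  by move=> eEP; rewrite !inE; split; apply/exists_inP; exists e; rewrite ?eqxx ?orbT.
have rep_in c : c \in eset C -> rep c \in c.2 by move/hrep=> [].
have rep_mem c c' : c \in eset C -> c' \in eset C -> rep c' \in c.2 -> c' = c.
  move=> cI cI' h; apply: contraTeq h => ncc.
  by rewrite (disjointFr (disC c' c cI' cI ncc)) // rep_in.
have rep_inj : {in eset C &, injective rep}.
  by move=> c c' cI cI' eq_rep; apply: rep_mem => //; rewrite eq_rep rep_in.
have repT c : c \in eset C -> rep c \in T.
  by move=> cI; apply: subsetP (subC c cI) _ (rep_in c cI).
have nEP e : e \in eset G -> e \in EP = false by move=> eG; rewrite (disjointFl disEP).
have TnEP e : e \in T -> e \in EP = false by move=> /(subsetP TG)/nEP.
(* Injectivity of [rep] forces the choice made in [identify] to be [c], and names in [T] are not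
   overridden by the ends of new edges. *)
have ends_rep c : c \in eset C -> ends C1 (rep c) = c.1.
  move=> cI /=; rewrite TnEP ?repT //; case: pickP => [c' /andP[cI' /eqP eq_rep]|].
    by rewrite (rep_inj _ _ cI' cI eq_rep) eC.
  by move/(_ c); rewrite cI eqxx.
have ends_EP (H : mgraph V E) e : e \in EP -> ends (add_edges H EP endsP) e = endsP e.
  by move=> eEP /=; rewrite eEP.
have ends_G e : e \in eset G -> ends G1 e = ends G e by move=> eG /=; rewrite nEP.
have rep_C c : c \in eset C -> rep c \in eset C1.
  by move=> cI; rewrite inE imset_f.
have wfG1 : wf_mgraph G1.
  move=> e /setUP[eG|eEP]; first by rewrite ends_G //; apply: wfG.
  by rewrite ends_EP //; have [? ?] := endsS e eEP; split; apply: (subsetP SG).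
have wfC1 : wf_mgraph C1.
  move=> e /setUP[/imsetP[c cI ->]|eEP].
    by rewrite ends_rep // -eC; apply: wfC.
  by rewrite ends_EP //; have [? ?] := endsS e eEP; split; apply: (subsetP SC).
have [[MC1 cM acM] _] := mstM.
(* Only representatives are ever removed from [T], and by disjointness the path of [c] contains no
   representative except [rep c]. *)
have path_M' c : c \in eset C -> {in c.2, forall g, g != rep c -> g \in M'}.
  move=> cI g gc ngrep; rewrite !inE (subsetP (subC c cI)) //= andbT.
  rewrite negb_and negbK; apply/orP; right; apply/imsetP=> -[c' cI' eq_g].
  by rewrite eq_g (rep_mem c c') ?eqxx // -eq_g in ngrep.
have edge_rel_G r e : e \in T -> edge_rel G1 r e = edge_rel G r e.
  by move=> eT; rewrite /edge_rel ends_G // (subsetP TG).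
(* A new edge of [M] is itself in [M']. If [rep c] is in [M], it is not removed, so the whole path
   of [c] survives, and none of its edges is heavier than [rep c]. *)
have M_M' e t : e \in light w M t -> edge_rel C1 (conn G1 (light w M' t)) e.
  rewrite inE => /andP[eM le_et].
  have [eEP|/imsetP[c cI eq_e]] : e \in EP \/ e \in rep @: eset C.
    by apply/orP; rewrite orbC -in_setU; apply: (subsetP MC1).
    rewrite /edge_rel ends_EP // -(ends_EP G) //.
    by apply: (@conn_edge _ _ G1); rewrite !inE eM eEP le_et orbT.
  rewrite /edge_rel eq_e ends_rep //; have [ends_c _] := pathC c cI.
  apply: ends_c (conn_equiv _ _) _ => g gc.
  rewrite -edge_rel_G ?(subsetP (subC c cI)) //; apply: conn_edge.
  rewrite inE (le_trans _ le_et) ?andbT; last by rewrite eq_e; have [_] := hrep c cI; apply.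
  have [->|] := eqVneq g (rep c); last exact: path_M'.
  by rewrite -eq_e !inE eM /= eq_e repT.
have C1_M' e t : e \in eset C1 -> (w e <= t)%R -> edge_rel C1 (conn G1 (light w M' t)) e.
  move=> eC1 le_et; apply: conn_least (conn_equiv _ _) _ (mst_light wfC1 mstM eC1) => f.
  rewrite inE => /andP[fM le_fe].
  by apply: M_M'; rewrite inE fM (le_trans le_fe).
(* An edge of [T] missing from [M'] is some [rep c]. The rest of the path of [c] lies in [M'] and is
   no heavier, and the ends of [c] are joined below the same threshold by [C1_M']; together they
   close the cycle around the missing edge. *)
have T_M' e t : e \in light w T t -> edge_rel G1 (conn G1 (light w M' t)) e.
  rewrite inE => /andP[eT le_et]; have [eM'|eM'] := boolP (e \in M').
    by apply: conn_edge; rewrite inE eM'.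
  have /imsetP[c cI eq_e] : e \in eset C'.
    by apply: contraNT eM' => eC'; rewrite !inE (negPf eC') andbF eT.
  have [_ cycle_c] := pathC c cI; rewrite edge_rel_G //.
  apply: cycle_c (conn_equiv _ _) _ _ _; first by rewrite eq_e rep_in.
    move=> g /setD1P[nge gc]; rewrite -edge_rel_G ?(subsetP (subC c cI)) //.
    apply: conn_edge; rewrite inE (path_M' c) -?eq_e //=.
    by apply: le_trans le_et; rewrite eq_e; have [_] := hrep c cI; apply.
  have := C1_M' (rep c) t (rep_C c cI); rewrite /edge_rel ends_rep // -eq_e.
  exact.
have G1_M' : {in eset G1, forall e, edge_rel G1 (conn G1 (light w M' (w e))) e}.
  move=> e /setUP[eG|eEP].
    rewrite /edge_rel ends_G //.
    apply: conn_least (conn_equiv _ _) _ (mst_light wfG mstT eG) => f fT.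
    rewrite -edge_rel_G; first exact: T_M'.
    by move: fT; rewrite inE => /andP[].
  rewrite /edge_rel ends_EP // -(ends_EP C') //; apply: C1_M' => //.
  by rewrite inE eEP orbT.
apply: light_mst => //.
(* The added edges bring no vertices, so [T] still spans [G1] and serves as the reference for
   counting the edges of [M']. *)
have stT : spanning_tree G1 T.
  have [_ _ /acyclic_forest Tfor] := proj1 mstT.
  have kT (A : {set E}) x y : A \subset T -> conn G A x y = conn G1 A x y.
    move=> /subsetP AT; apply/idP/idP; apply: conn_least (conn_equiv _ _) _ => e eA.
      by rewrite -edge_rel_G ?AT //; apply: conn_edge.
    by rewrite edge_rel_G ?AT //; apply: conn_edge.
  split; first by rewrite subsetU ?TG.
    move=> x y xG yG; have := cT x y xG yG; rewrite -[connect _ x y]/(conn G T x y).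
    by rewrite kT.
  apply/acyclic_forest => e eT; rewrite edge_rel_G // /edge_rel -kT ?subD1set //.
  exact: Tfor.
apply: (spanning_tree_card wfG1 stT).
- apply/subsetP=> e; rewrite !inE => /andP[_ /orP[/(subsetP TG)->//|/andP[_ ->]]].
  exact: orbT.
- have [_ cT1 _] := stT; apply: connected_absorb cT1 _ => e eT.
  have eT' : e \in light w T (w e) by rewrite inE eT lexx.
  apply: conn_sub (T_M' e (w e) eT').
  by apply/subsetP=> f; rewrite inE => /andP[].
(* The edges of [C] alone already connect all vertices of [C1], which bounds the size of the forest
   [M]. *)
have leMC : #|M| <= #|eset C'|.
  apply: (@forest_card_le _ _ C1); first exact/acyclic_forest.
  move=> e /(subsetP MC1)/wfC1[e1 e2].
  apply: (conn_least (conn_equiv _ _) _ (cC _ _ e1 e2)) => c cI.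
  by rewrite /edge_rel eC -ends_rep //; apply: conn_edge; rewrite imset_f.
have CT : eset C' \subset T by apply/subsetP=> _ /imsetP[c cI ->]; apply: repT.
have dTM : [disjoint T & M :&: EP].
  by apply/pred0P=> e /=; rewrite !inE; case: (boolP (e \in T)) => //= /TnEP->; rewrite andbF.
have MEP : M :\: EP = eset C' :&: M.
  apply/setP=> e; rewrite !inE.
  have [eM|] := boolP (e \in M); last by rewrite !andbF.
  rewrite !andbT; have := subsetP MC1 e eM; rewrite inE.
  have [eC'|_ /= ->//] := boolP (e \in eset C').
  by rewrite TnEP ?(subsetP CT).
have cardM' := cardsD (T :|: (M :&: EP)) (eset C' :\: M).
have capE : (T :|: (M :&: EP)) :&: (eset C' :\: M) = eset C' :\: M.
  apply/setIidPr; apply: subset_trans (subsetDl _ _) _.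
  exact: subset_trans CT (subsetUl _ _).
(* What remains is that [M :&: EP] has at most as many edges as [eset C' :\: M]. Adding the common
   part [M :\: EP], equal to [eset C' :&: M], to both sides turns this into [leMC]. *)
rewrite /M' cardM' capE cardsU (disjoint_setI0 dTM) cards0 subn0 leq_subLR addnC leq_add2r.
rewrite -(leq_add2r #|M :\: EP|) cardsID MEP addnC.
by rewrite cardsID.
Qed.
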